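(* Let $u$ be an indeterminate, and define the following elements of $\mathbb{Q}(u)$: $$m=-\frac{4(u-1)(u^8-8u^7+34u^6-92u^5+178u^4-248u^3+232u^2-128u+32)}{(u^2-2u+4)(3u^2-6u+4)^2},$$ $$w=\frac{m^2+2(u-1)(u^2-2u+4)m+8(u-1)^2}{(u-1)m^2-8(u-1)^3},$$ $$\alpha=u^4w^2+4w^4-8w^4u+4w^4u^2+8w^2-16w^2u+12w^2u^2+4-8u+4u^2-4w^2u^3,$$ $$n^2=(w^4-1)^2u^2(u-2)^2(u-1)^2.$$ Then the elliptic curve $E: y^2=x^3+\alpha x^2-n^2x$ over $\mathbb{Q}(u)$ has five $\mathbb{Q}(u)$-rational points with respective $x$-coordinates $$x_1=-(w-1)^2(w+1)^2u^2(u-1),\quad x_2=-u^2w^2(u-2)^2,\quad x_3=-4(w^2+1)^2(u-1)^2,$$ $$x_4=(w^4-1)u^2(u-1),\quad x_5=-u^2(u-1)(w^4-1),$$ and these five points are linearly independent. Hence this family of elliptic curves has rank at least $5$, i.e. $E(\mathbb{Q}(u))$ has rank at least $5$.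
   Context: Points are linearly independent if they are independent over $\mathbb{Z}$ in the Mordell–Weil group, i.e. no nontrivial integer linear combination of them is the identity. *)

(* Defs.v *)
From HB Require Import structures.
From mathcomp Require Import all_boot all_order all_algebra.
From mathcomp Require Import ring.

Set Implicit Arguments.
Unset Strict Implicit.
Unset Printing Implicit Defensive.

Import GRing.Theory.
Local Open Scope ring_scope.

(* Q(u), where u is the image of 'X. *)
Definition ratfun : fieldType := {fraction {poly rat}}.

(* The cubic y^2 = x^3 + a2 x^2 + a4 x + a6.  It is an elliptic curve exactly
   when [disc] is nonzero; in characteristic 2 [disc] is always 0. *)
Record cubic (K : fieldType) := Cubic { a2 : K; a4 : K; a6 : K }.

Definition disc (K : fieldType) (E : cubic K) : K :=
  16 * (a2 E ^+ 2 * a4 E ^+ 2 - 4 * a4 E ^+ 3 - 4 * a2 E ^+ 3 * a6 E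
        + 18 * a2 E * a4 E * a6 E - 27 * a6 E ^+ 2).

Definition is_elliptic (K : fieldType) (E : cubic K) : bool := disc E != 0.

Inductive point (K : Type) := Infinity | Affine of K & K.
Arguments Infinity {K}.

Definition on_curve (K : fieldType) (E : cubic K) (P : point K) : bool :=
  match P with
  | Infinity => true
  | Affine x y => y ^+ 2 == x ^+ 3 + a2 E * x ^+ 2 + a4 E * x + a6 E
  end.

Record mw_point (K : fieldType) (E : cubic K) :=
  MWPoint { mw_val :> point K; mw_valP : on_curve E mw_val }.

Definition raw_opp (K : fieldType) (P : point K) : point K :=
  match P with
  | Infinity => Infinity
  | Affine x y => Affine x (- y)
  end.

(* Chord-tangent law.  The tangent slope is only used for two points of the
   curve with x1 = x2 and y1 <> - y2, so that y1 = y2 and 2 * y1 <> 0. *)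
Definition raw_add (K : fieldType) (E : cubic K) (P Q : point K) : point K :=
  match P, Q with
  | Infinity, _ => Q
  | _, Infinity => P
  | Affine x1 y1, Affine x2 y2 =>
      if (x1 == x2) && (y1 == - y2) then Infinity
      else
        let s := if x1 == x2
                 then (3 * x1 ^+ 2 + 2 * a2 E * x1 + a4 E) / (2 * y1)
                 else (y2 - y1) / (x2 - x1) in
        let x3 := s ^+ 2 - a2 E - x1 - x2 in
        Affine x3 (s * (x1 - x3) - y1)
  end.

Lemma on_curve_opp (K : fieldType) (E : cubic K) (P : point K) :
  on_curve E P -> on_curve E (raw_opp P).
Proof. by case: P => [|x y] //=; rewrite sqrrN. Qed.

Lemma on_curve_third (K : fieldType) (a b c x1 y1 x2 s : K) :
    y1 ^+ 2 = x1 ^+ 3 + a * x1 ^+ 2 + b * x1 + c ->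
    x2 ^+ 2 + x2 * x1 + x1 ^+ 2 + a * (x2 + x1) + b
      - s ^+ 2 * (x2 - x1) - 2 * s * y1 = 0 ->
  let x3 := s ^+ 2 - a - x1 - x2 in
  (s * (x1 - x3) - y1) ^+ 2 = x3 ^+ 3 + a * x3 ^+ 2 + b * x3 + c.
Proof.
move=> h1 h2 x3; apply/eqP; rewrite -subr_eq0; apply/eqP.
transitivity ((y1 ^+ 2 - (x1 ^+ 3 + a * x1 ^+ 2 + b * x1 + c))
   - (x3 - x1) * (x2 ^+ 2 + x2 * x1 + x1 ^+ 2 + a * (x2 + x1) + b
      - s ^+ 2 * (x2 - x1) - 2 * s * y1)); first by rewrite /x3; ring.
by rewrite h1 h2; ring.
Qed.

Lemma on_curve_add (K : fieldType) (E : cubic K) (P Q : point K) :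
  on_curve E P -> on_curve E Q -> on_curve E (raw_add E P Q).
Proof.
case: P => [|x1 y1] //; case: Q => [|x2 y2] //= /eqP h1 /eqP h2.
case: ifPn => //= nopp; apply/eqP; apply: on_curve_third => //.
move: nopp; case: (eqVneq x1 x2) h2 => [<-|nx] h2 /= ny.
  have e : y1 = y2.
    apply/eqP; rewrite -subr_eq0.
    have /eqP: (y1 - y2) * (y1 + y2) = 0 by rewrite -subr_sqr h1 h2 subrr.
    by rewrite mulf_eq0 (addr_eq0 y1 y2) (negPf ny) orbF => /eqP ->.
  have y0 : 2 * y1 != 0.
    by rewrite mulr_natl mulr2n addr_eq0 {2}e.
  set s := _ / _.
  have hs : s * (2 * y1) = 3 * x1 ^+ 2 + 2 * a2 E * x1 + a4 E by rewrite divfK.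
  transitivity (3 * x1 ^+ 2 + 2 * a2 E * x1 + a4 E - s * (2 * y1)); first by ring.
  by rewrite hs subrr.
have dx : x2 - x1 != 0 by rewrite subr_eq0 eq_sym.
set s := _ / _.
have hs : s * (x2 - x1) = y2 - y1 by rewrite divfK.
apply: (mulfI dx); rewrite mulr0.
transitivity ((x2 ^+ 3 + a2 E * x2 ^+ 2 + a4 E * x2 + a6 E)
   - (x1 ^+ 3 + a2 E * x1 ^+ 2 + a4 E * x1 + a6 E)
   - (s * (x2 - x1)) ^+ 2 - 2 * (s * (x2 - x1)) * y1); first by ring.
by rewrite -h1 -h2 hs; ring.
Qed.

Section MordellWeil.
Variables (K : fieldType) (E : cubic K).

Definition mw_zero : mw_point E := @MWPoint K E Infinity isT.

Definition mw_opp (P : mw_point E) : mw_point E :=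
  MWPoint (on_curve_opp (mw_valP P)).

Definition mw_add (P Q : mw_point E) : mw_point E :=
  MWPoint (on_curve_add (mw_valP P) (mw_valP Q)).

Definition mw_mulz (P : mw_point E) (c : int) : mw_point E :=
  match c with
  | Posz n => iter n (mw_add P) mw_zero
  | Negz n => mw_opp (iter n.+1 (mw_add P) mw_zero)
  end.

Definition has_x (P : mw_point E) (x : K) : Prop :=
  exists y : K, mw_val P = Affine x y.

Definition lin_indep (r : nat) (P : 'I_r -> mw_point E) : Prop :=
  forall c : 'I_r -> int,
    \big[mw_add/mw_zero]_(i < r) mw_mulz (P i) (c i) = mw_zero ->
    forall i, c i = 0.

(* The rank of an abelian group is the supremum of the sizes of its finite
   linearly independent families. *)
Definition rank_ge (r : nat) : Prop :=
  exists P : 'I_r -> mw_point E, lin_indep P.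

End MordellWeil.

(* Main.v *)
From HB Require Import structures.
Require Import Defs.
From mathcomp Require Import all_boot all_order all_algebra.
From mathcomp Require Import ring.
Set Implicit Arguments.
Unset Strict Implicit.
Unset Printing Implicit Defensive.
Import GRing.Theory Num.Theory.
Local Open Scope ring_scope.

(** Put t = u - 1, v = t^2 and n = (w^4 - 1) u (u - 2) t.  Then
    alpha = 4 t^2 (w^2 + 1)^2 + w^2 u^2 (u - 2)^2, and on
    y^2 = x^3 + alpha x^2 - n^2 x the abscissae x1, x2, x3 have ordinates
    polynomial in u and w.  With C = x4 = - x5 the cubic takes at x4 and x5 the
    values C^2 w^2 r^2 and C^2 s^2, where
      r^2 = 8 t^2 (w^2 + 1) + u^2 (u - 2)^2,
      s^2 = 8 t^2 (w^2 + 1) + w^2 u^2 (u - 2)^2,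
    and the value of m is such that w = A(v) / (t B(v)) for two polynomials of
    degree 8 with mutually reversed coefficients, for which r and s are rational
    functions as well ([w_of_m], [square_r], [square_s]).

    Independence rests on Manin's homomorphism from E(Q(u)) to the additive
    group of Q(u).  In the coordinates X = x / n, Y = y / n the curve is
    Y^2 = n (X^3 + a X^2 - X) with a = alpha / n, a quadratic twist by n of the
    family Z^2 = X^3 + a X^2 - X.  The form omega = dX / Z satisfies the
    Picard-Fuchs equation
      (a^2 + 4) omega'' + 2 a omega' + omega / 4 = - d (X^2 (X^2 + 1) / (2 Z^3)),
    where the primes are derivatives in a at constant X.  Applying the operator
    on the left to the integral of omega from the origin to a point P, whose
    coordinates vary with u, gives up to a common factor the rational expression
    [manin] in the coordinates of P and their first two derivatives.  It is additive in P
    because the integral is additive up to periods and the operator kills the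
    periods; [manin_point_add] proves this algebraically, for one application of
    the chord-tangent law.  Hence a relation between points gives the same
    relation between their images in the torsion-free group Q(u) ([hom_sum]).

    It remains to see that the images of the five points are linearly
    independent over Z.  Their values at u = 3, 4, 5, 6, 7 modulo 11 form an
    invertible matrix ([red_manin_gen], [manin_rows_inverseP]); so the coefficients
    of any relation are divisible by 11, and after division by 11 they give
    another relation ([relation_descent]). *)

(** * Derivations of a field *)

Definition derivation (K : fieldType) (D : K -> K) : Prop :=
  {morph D : x y / x + y} /\ forall x y, D (x * y) = D x * y + x * D y.

Section Derivation.
Variables (K : fieldType) (D : K -> K).
Hypothesis derD : derivation D.

Lemma der_add x y : D (x + y) = D x + D y. Proof. exact: derD.1. Qed.
Lemma der_mul x y : D (x * y) = D x * y + x * D y. Proof. exact: derD.2. Qed.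

Lemma der0 : D 0 = 0.
Proof. by apply: (addrI (D 0)); rewrite -der_add !addr0. Qed.

Lemma der1 : D 1 = 0.
Proof. by apply: (addrI (D 1)); rewrite addr0 -{3}[1]mulr1 der_mul mulr1 mul1r. Qed.

Lemma der_opp x : D (- x) = - D x.
Proof. by apply/eqP; rewrite -addr_eq0 -der_add addNr der0. Qed.

Lemma der_sub x y : D (x - y) = D x - D y.
Proof. by rewrite der_add der_opp. Qed.

Lemma der_nat k : D k%:R = 0.
Proof. by elim: k => [|k IH]; rewrite ?der0 // -addn1 natrD der_add IH der1 addr0. Qed.

Lemma der_exp x k : D (x ^+ k.+1) = k.+1%:R * x ^+ k * D x.
Proof.
elim: k => [|k IH]; first by rewrite expr0 expr1 !mul1r.
by rewrite exprS der_mul IH -[k.+2%:R]natr1 exprS; ring.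
Qed.

Lemma der_inv x : x != 0 -> D (x^-1) = - (D x / x ^+ 2).
Proof.
move=> x0; have : D (x * x^-1) = 0 by rewrite divff ?der1.
rewrite der_mul => /eqP; rewrite addrC addr_eq0 => /eqP e.
by apply: (mulfI x0); rewrite e; field.
Qed.

Lemma der_div x y : y != 0 -> D (x / y) = (D x * y - x * D y) / y ^+ 2.
Proof. by move=> y0; rewrite der_mul der_inv //; field. Qed.

End Derivation.

(** Discharges the non-vanishing conditions that [field] leaves. *)
Ltac nonzero :=
  repeat first [assumption | apply/andP; split | rewrite oppr_eq0 | apply: mulf_neq0].

(** * The Manin map *)

Section Manin.
Variables (K : fieldType) (D : K -> K).
Hypotheses (derD : derivation D) (two_neq0 : (2 : K) != 0).

(** The Picard-Fuchs operator in the parameter a, applied to the integral of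
    dX / Z and multiplied by D a / sqrt n, where Z = Y / sqrt n.  The term
    D n / (2 n) comes from differentiating the square root of n, and the one in
    X ^ 2 * D X from omega' = - X^2 / (2 Z^3) dX.  At Y = 0 each term contains the
    inverse of 0, so that the value is 0, as it must be at a point of order 2. *)
Definition manin (n a X Y : K) : K :=
  (a ^+ 2 + 4) * (D (D X / Y / D a) + D n / (2 * n) * (D X / Y / D a)
                  - n * X ^+ 2 * D X / (2 * Y ^+ 3))
  + 2 * a * (D X / Y)
  - n * D a * (X ^+ 2 * (X ^+ 2 + 1)) / (2 * Y ^+ 3).

Variables (n a : K).
Hypotheses (n_neq0 : n != 0) (Da_neq0 : D a != 0).

Lemma four_neq0 : (4 : K) != 0.
Proof. by rewrite (_ : 4 = 2 * 2) ?mulf_neq0 //; ring. Qed.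

Lemma manin_y0 X : manin n a X 0 = 0.
Proof. by rewrite /manin expr0n !(mulr0, invr0, mul0r) (der0 derD) ?(addr0, subr0, mulr0). Qed.

Lemma maninN X Y : manin n a X (- Y) = - manin n a X Y.
Proof.
have [->|Y0] := eqVneq Y 0.
  by rewrite oppr0 manin_y0 oppr0.
rewrite /manin.
have -> : D X / - Y / D a = - (D X / Y / D a) by field; nonzero.
by rewrite (der_opp derD); field; nonzero.
Qed.

(** Additivity for three points of the line Y = s X + t that avoid the points of
    order 2; the hypotheses compare the coefficients of the two sides of
    n (X^3 + a X^2 - X) - (s X + t)^2 = n (X - X1) (X - X2) (X - X3), so tangent
    lines are included.  They express n, s and a by X1, X2, X3 and t.  By Abel's
    theorem the sum of the D Xi / Yi vanishes when a is constant, so it is a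
    multiple k * D a.  The second derivatives enter [manin] only through
    D (D X / Y / D a), and there they add up to D k: what is left is an identity
    of rational functions that is linear in the first derivatives. *)
Lemma manin_collinear X1 X2 X3 s t :
  X1 != 0 -> X2 != 0 -> X3 != 0 ->
  s * X1 + t != 0 -> s * X2 + t != 0 -> s * X3 + t != 0 ->
  t ^+ 2 = n * (X1 * X2 * X3) ->
  n * (1 + X1 * X2 + X2 * X3 + X3 * X1) = - (2 * s * t) ->
  n * (a + X1 + X2 + X3) = s ^+ 2 ->
  manin n a X1 (s * X1 + t) + manin n a X2 (s * X2 + t) + manin n a X3 (s * X3 + t) = 0.
Proof.
move=> h1 h2 h3 y1 y2 y3 e0 e1 e2; have h4 := four_neq0.
have t0 : t != 0.
  by apply: contra_neq n_neq0 => t0; apply/eqP; move/esym/eqP: e0;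
     rewrite t0 expr0n !mulf_eq0 (negPf h1) (negPf h2) (negPf h3) !orbF.
have en : n = t ^+ 2 / (X1 * X2 * X3) by rewrite e0; field; nonzero.
have es : s = - (t * (1 + X1 * X2 + X2 * X3 + X3 * X1) / (2 * (X1 * X2 * X3))).
  have -> : s = - (n * (1 + X1 * X2 + X2 * X3 + X3 * X1)) / (2 * t).
    by rewrite e1; field; nonzero.
  by rewrite en; field; nonzero.
have ea : a = (1 + X1 * X2 + X2 * X3 + X3 * X1) ^+ 2 / (4 * (X1 * X2 * X3))
              - (X1 + X2 + X3).
  have -> : a = s ^+ 2 / n - (X1 + X2 + X3) by rewrite -e2; field.
  by rewrite es en; field; nonzero.
(* Yi is a multiple of Ni, so Ni = 0 at a point of order 2 *)
pose N1 := X2 * X3 - 1 - X1 * (X2 + X3).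
pose N2 := X3 * X1 - 1 - X2 * (X3 + X1).
pose N3 := X1 * X2 - 1 - X3 * (X1 + X2).
have eY1 : s * X1 + t = t * X1 * N1 / (2 * (X1 * X2 * X3)).
  by rewrite es /N1; field; nonzero.
have eY2 : s * X2 + t = t * X2 * N2 / (2 * (X1 * X2 * X3)).
  by rewrite es /N2; field; nonzero.
have eY3 : s * X3 + t = t * X3 * N3 / (2 * (X1 * X2 * X3)).
  by rewrite es /N3; field; nonzero.
have m1 : N1 != 0 by apply: contra_neq y1 => m; rewrite eY1 m mulr0 mul0r.
have m2 : N2 != 0 by apply: contra_neq y2 => m; rewrite eY2 m mulr0 mul0r.
have m3 : N3 != 0 by apply: contra_neq y3 => m; rewrite eY3 m mulr0 mul0r.
rewrite {}eY1 {}eY2 {}eY3; clear y1 y2 y3 e0 e1 e2 es.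
set Y1 := t * X1 * N1 / _; set Y2 := t * X2 * N2 / _; set Y3 := t * X3 * N3 / _.
pose k := - (8 * (X1 * X2 * X3) ^+ 2 / (N1 * N2 * N3 * t)).
have eDa : D a = - (N1 * N2 * N3 / (4 * (X1 * X2 * X3)))
              * (D X1 / (X1 * N1) + D X2 / (X2 * N2) + D X3 / (X3 * N3)).
  rewrite ea (der_sub derD) (der_div derD) ?mulf_neq0 //.
  rewrite (der_exp derD) !(der_add derD, der_mul derD, der_nat derD).
  rewrite (der1 derD).
  move: m1 m2 m3; rewrite /N1 /N2 /N3 => m1 m2 m3.
  by field; nonzero.
have eS : D X1 / Y1 + D X2 / Y2 + D X3 / Y3 = k * D a.
  rewrite eDa /k /Y1 /Y2 /Y3.
  by field; nonzero.
have eK : D X1 / Y1 / D a + D X2 / Y2 / D a + D X3 / Y3 / D a = k.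
  by rewrite -!mulrDl eS mulfK.
have eDk : D k + D n / (2 * n) * k
    = k * (3 / 2 * (D X1 / X1 + D X2 / X2 + D X3 / X3)
       - (D N1 / N1 + D N2 / N2 + D N3 / N3)).
  rewrite /k en (der_opp derD) !(der_div derD) ?mulf_neq0 //.
  rewrite !(der_exp derD) !(der_mul derD, der_nat derD, der_exp derD).
  by field; nonzero.
have eN1 : D N1 = D X2 * X3 + X2 * D X3 - D X1 * (X2 + X3) - X1 * (D X2 + D X3).
  by rewrite !(der_sub derD, der_add derD, der_mul derD, der1 derD); ring.
have eN2 : D N2 = D X3 * X1 + X3 * D X1 - D X2 * (X3 + X1) - X2 * (D X3 + D X1).
  by rewrite !(der_sub derD, der_add derD, der_mul derD, der1 derD); ring.
have eN3 : D N3 = D X1 * X2 + X1 * D X2 - D X3 * (X1 + X2) - X3 * (D X1 + D X2).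
  by rewrite !(der_sub derD, der_add derD, der_mul derD, der1 derD); ring.
transitivity ((a ^+ 2 + 4) * (D k + D n / (2 * n) * k
     - n * (X1 ^+ 2 * D X1 / (2 * Y1 ^+ 3) + X2 ^+ 2 * D X2 / (2 * Y2 ^+ 3)
            + X3 ^+ 2 * D X3 / (2 * Y3 ^+ 3)))
   + 2 * a * (k * D a)
   - n * D a * (X1 ^+ 2 * (X1 ^+ 2 + 1) / (2 * Y1 ^+ 3)
       + X2 ^+ 2 * (X2 ^+ 2 + 1) / (2 * Y2 ^+ 3)
       + X3 ^+ 2 * (X3 ^+ 2 + 1) / (2 * Y3 ^+ 3))).
  rewrite -eS -{1 2}eK !(der_add derD) /manin; ring.
rewrite eDk eN1 eN2 eN3 eDa {1 2}ea en /k /Y1 /Y2 /Y3 /N1 /N2 /N3.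
move: m1 m2 m3; rewrite /N1 /N2 /N3 => m1 m2 m3.
by field; nonzero.
Qed.

(** Translation by the point (0, 0) of order 2 is (X, Y) -> (-1/X, Y/X^2), which
    preserves dX / Y; the second point below is the opposite of the translate. *)
Lemma manin_translate0 X Y : X != 0 ->
  manin n a X Y + manin n a (- X^-1) (- (Y / X ^+ 2)) = 0.
Proof.
move=> X0; have [->|Y0] := eqVneq Y 0.
  by rewrite mul0r oppr0 !manin_y0 addr0.
have eD : D (- X^-1) = D X / X ^+ 2 by rewrite (der_opp derD) (der_inv derD) // opprK.
rewrite /manin eD.
have -> : D X / X ^+ 2 / - (Y / X ^+ 2) = - (D X / Y).
  by field; nonzero.
rewrite mulNr (der_opp derD).
by field; nonzero.
Qed.

(** Translation by another point (e, 0) of order 2.  Here a = 1/e - e, so that e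
    varies with a, and the terms D X / Y of the translate and of the given point
    differ by a multiple q * D a of D a. *)
Lemma manin_translate e X s :
  e != 0 -> s != 0 -> e ^+ 2 + 1 != 0 -> X != 0 -> X - e != 0 -> 1 + e * X != 0 ->
  a = e^-1 - e -> s ^+ 2 * e = n * X * ((1 + e * X) / (X - e)) ->
  manin n a X (s * (X - e))
  + manin n a ((1 + e * X) / (X - e)) (s * ((e ^+ 2 + 1) / (X - e))) = 0.
Proof.
move=> e0 s0 e1 X0 Xe X3 ea es; have h4 := four_neq0.
have en : n = s ^+ 2 * e * (X - e) / (X * (1 + e * X)).
  by rewrite es; field; nonzero.
have eDa : D a = - (D e * (1 + e ^+ 2) / e ^+ 2).
  by rewrite ea (der_sub derD) (der_inv derD) //; field.
have De : D e != 0 by apply: contra_neq Da_neq0 => h; rewrite eDa h !mul0r oppr0.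
have e1' : 1 + e ^+ 2 != 0 by rewrite addrC.
pose Z := (1 + e * X) / (X - e).
pose q := - (e ^+ 2 * (X ^+ 2 + 1) / ((1 + e ^+ 2) ^+ 2 * (s * (X - e)))).
have eDZ : D Z = (D e * (X ^+ 2 + 1) - (e ^+ 2 + 1) * D X) / (X - e) ^+ 2.
  rewrite (der_div derD) // (der_add derD) (der_sub derD) (der1 derD).
  by rewrite (der_mul derD); field.
have eP : D Z / (s * ((e ^+ 2 + 1) / (X - e))) / D a = - (D X / (s * (X - e)) / D a) + q.
  rewrite eDZ eDa /q.
  by field; nonzero.
have eDq : D q = q * (2 * D e / e - 4 * e * D e / (1 + e ^+ 2) - D s / s
                      - (D X - D e) / (X - e))
   - e ^+ 2 * (2 * X * D X) / ((1 + e ^+ 2) ^+ 2 * (s * (X - e))).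
  rewrite /q (der_opp derD) (der_div derD) ?mulf_neq0 ?expf_neq0 //.
  rewrite !(der_mul derD, der_sub derD, der_add derD, der_opp derD, der_exp derD, der1 derD).
  by field; nonzero.
have eDn : D n = n * (2 * D s / s + D e / e + (D X - D e) / (X - e) - D X / X
                      - (D e * X + e * D X) / (1 + e * X)).
  rewrite en (der_div derD) ?mulf_neq0 ?expf_neq0 //.
  rewrite !(der_mul derD, der_sub derD, der_add derD, der_opp derD, der_exp derD, der1 derD).
  by field; nonzero.
have e3 : D Z / (s * ((e ^+ 2 + 1) / (X - e))) = - (D X / (s * (X - e))) + q * D a.
  by apply: (mulIf (invr_neq0 Da_neq0)); rewrite eP; field; nonzero.
rewrite -/Z /manin eP e3 (der_add derD) (der_opp derD) eDq eDn.
set P := D X / _ / D a.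
transitivity ((a ^+ 2 + 4) * (q * (2 * D e / e - 4 * e * D e / (1 + e ^+ 2) - D s / s
                      - (D X - D e) / (X - e))
   - e ^+ 2 * (2 * X * D X) / ((1 + e ^+ 2) ^+ 2 * (s * (X - e)))
   + (2 * D s / s + D e / e + (D X - D e) / (X - e) - D X / X
                      - (D e * X + e * D X) / (1 + e * X)) / 2 * q
   - n * (X ^+ 2 * D X / (2 * (s * (X - e)) ^+ 3)
          + Z ^+ 2 * D Z / (2 * (s * ((e ^+ 2 + 1) / (X - e))) ^+ 3)))
  + 2 * a * (q * D a)
  - n * D a * (X ^+ 2 * (X ^+ 2 + 1) / (2 * (s * (X - e)) ^+ 3)
          + Z ^+ 2 * (Z ^+ 2 + 1) / (2 * (s * ((e ^+ 2 + 1) / (X - e))) ^+ 3))).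
  by field; nonzero.
rewrite eDZ eDa {1 2}ea en /q /Z.
by field; nonzero.
Qed.

(** A line through a point of order 2, where [manin] vanishes: the two other
    intersections differ by a translation and a sign. *)
Lemma manin_line_root X1 X2 X3 s t :
  s * X1 + t = 0 ->
  t ^+ 2 = n * (X1 * X2 * X3) ->
  n * (1 + X1 * X2 + X2 * X3 + X3 * X1) = - (2 * s * t) ->
  n * (a + X1 + X2 + X3) = s ^+ 2 ->
  manin n a X2 (s * X2 + t) + manin n a X3 (s * X3 + t) = 0.
Proof.
move=> /eqP; rewrite addrC addr_eq0 => /eqP -> c0 c1 c2.
have [s0|s0] := eqVneq s 0.
  by rewrite s0 !mul0r oppr0 !addr0 !manin_y0 addr0.
have [e0|e0] := eqVneq X1 0.
  have /eqP : n * (1 + X2 * X3) = 0.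
    transitivity (n * (1 + X1 * X2 + X2 * X3 + X3 * X1)); first by rewrite e0; ring.
    by rewrite c1 e0; ring.
  rewrite mulf_eq0 (negPf n_neq0) addrC addr_eq0 /= => /eqP X23.
  have X2n0 : X2 != 0.
    by apply: contra_eq_neq X23 => ->; rewrite mul0r eq_sym oppr_eq0 oner_neq0.
  have -> : X3 = - X2^-1 by apply: (mulfI X2n0); rewrite X23 mulrN divff.
  rewrite -[RHS](manin_translate0 (s * X2) X2n0) e0; congr (manin _ _ _ _ + manin _ _ _ _).
    by ring.
  by field.
have c0' : s ^+ 2 * X1 = n * X2 * X3.
  by apply: (mulfI e0); transitivity ((- (s * X1)) ^+ 2); [ring | rewrite c0; ring].
have X3E : X3 * (X2 - X1) = 1 + X1 * X2.
  apply: (mulfI n_neq0); apply/eqP; rewrite -subr_eq0; apply/eqP.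
  transitivity (2 * (n * X2 * X3) - n * (1 + X1 * X2 + X2 * X3 + X3 * X1)); first by ring.
  by rewrite c1 -c0'; ring.
have aE : a = X1^-1 - X1.
  have aE' : X1 * (a + X1 + X2 + X3) = X2 * X3.
    apply: (mulfI n_neq0); transitivity (X1 * (n * (a + X1 + X2 + X3))); first by ring.
    by rewrite c2 mulrC c0' -mulrA.
  apply: (mulfI e0).
  transitivity (X1 * (a + X1 + X2 + X3) - X1 * X1 - X1 * X2 - X3 * X1).
    by ring.
  rewrite aE'; transitivity (X3 * (X2 - X1) - X1 * X2 - X1 * X1); first by ring.
  by rewrite X3E; field.
(* e^2 = -1 would make a constant *)
have e1 : X1 ^+ 2 + 1 != 0.
  apply: contra_neq Da_neq0 => h.
  have -> : a = - (2 * X1).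
    by rewrite aE; transitivity ((X1 ^+ 2 + 1) / X1 - 2 * X1); [field | rewrite h; ring].
  have := congr1 D h; rewrite (der_add derD) (der1 derD) (der_exp derD) (der0 derD) addr0.
  move/eqP; rewrite expr1 !mulf_eq0 (negPf two_neq0) (negPf e0) /= => /eqP De.
  by rewrite (der_opp derD) (der_mul derD) De (der_nat derD) mul0r mulr0 addr0 oppr0.
have X21 : X2 - X1 != 0.
  apply: contra_neq e1 => h; move: X3E; rewrite h mulr0.
  by move/eqP: h; rewrite subr_eq0 => /eqP ->; rewrite addrC -expr2.
have X2n0 : X2 != 0.
  by apply: contra_eq_neq c0' => ->; rewrite mulr0 mul0r mulf_neq0 // expf_neq0.
have X3n0 : X3 != 0.
  by apply: contra_eq_neq c0' => ->; rewrite mulr0 mulf_neq0 // expf_neq0.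
have X2' : 1 + X1 * X2 != 0 by rewrite -X3E mulf_neq0.
have X3E' : X3 = (1 + X1 * X2) / (X2 - X1) by rewrite -X3E mulfK.
rewrite X3E' in c0' *.
rewrite -[RHS](manin_translate e0 s0 e1 X2n0 X21 X2' aE c0').
by congr (manin _ _ _ _ + manin _ _ _ _); [ring | field].
Qed.

Lemma manin_line X1 X2 X3 s t :
  t ^+ 2 = n * (X1 * X2 * X3) ->
  n * (1 + X1 * X2 + X2 * X3 + X3 * X1) = - (2 * s * t) ->
  n * (a + X1 + X2 + X3) = s ^+ 2 ->
  manin n a X1 (s * X1 + t) + manin n a X2 (s * X2 + t) + manin n a X3 (s * X3 + t) = 0.
Proof.
move=> c0 c1 c2.
have [y1|y1] := eqVneq (s * X1 + t) 0.
  by rewrite {1}y1 manin_y0 add0r (manin_line_root y1).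
have [y2|y2] := eqVneq (s * X2 + t) 0.
  rewrite {1}y2 manin_y0 addr0 addrC (@manin_line_root X2) //.
  - by rewrite c0; ring.
  - by rewrite -c1; ring.
  - by rewrite -c2; ring.
have [y3|y3] := eqVneq (s * X3 + t) 0.
  rewrite {1}y3 manin_y0 addr0 (@manin_line_root X3) //.
  - by rewrite c0; ring.
  - by rewrite -c1; ring.
  - by rewrite -c2; ring.
have [e3|e3] := eqVneq (X1 * X2 * X3) 0; last first.
  move: (e3); rewrite !mulf_eq0 !negb_or -andbA => /and3P [h1 h2 h3].
  exact: manin_collinear.
move: c0; rewrite e3 mulr0 => /eqP; rewrite expf_eq0 /= => /eqP t0.
move/eqP: e3; move: y1 y2 y3; rewrite t0 !addr0 !mulf_eq0 !negb_or.
by move=> /andP[_ /negPf->] /andP[_ /negPf->] /andP[_ /negPf->].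
Qed.

Definition manin_point (P : point K) : K :=
  if P is Affine x y then manin n a (x / n) (y / n) else 0.

Lemma manin_point_opp P : manin_point (raw_opp P) = - manin_point P.
Proof. by case: P => [|x y] /=; rewrite ?oppr0 // mulNr maninN. Qed.

(** The Manin map is additive on the chord-tangent sum; after scaling by n, the
    line through the two points satisfies the hypotheses of [manin_line], in the
    chord case as in the tangent case. *)
Lemma manin_point_add (E : cubic K) P Q :
  a2 E = n * a -> a4 E = - n ^+ 2 -> a6 E = 0 ->
  on_curve E P -> on_curve E Q ->
  manin_point (raw_add E P Q) = manin_point P + manin_point Q.
Proof.
move=> E2 E4 E6; case: P => [|x1 y1]; first by rewrite add0r.
case: Q => [|x2 y2]; first by rewrite addr0.
rewrite /= E2 E4 E6 => /eqP h1 /eqP h2.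
case: ifPn => [/andP[/eqP -> /eqP ->]|nopp].
  by rewrite mulNr maninN addNr.
set s := (if _ then _ else _).
have hs : x2 ^+ 2 + x2 * x1 + x1 ^+ 2 + n * a * (x2 + x1) - n ^+ 2
      - s ^+ 2 * (x2 - x1) - 2 * s * y1 = 0 /\ y2 = y1 + s * (x2 - x1).
  rewrite /s; move: nopp; case: (eqVneq x1 x2) h2 => [<-|nx] h2 /= ny.
    have ey : y1 = y2.
      apply/eqP; rewrite -subr_eq0.
      have /eqP: (y1 - y2) * (y1 + y2) = 0 by rewrite -subr_sqr h1 h2 subrr.
      by rewrite mulf_eq0 (addr_eq0 y1 y2) (negPf ny) orbF => /eqP ->.
    have y0 : y1 != 0.
      by apply: contra_neq ny => y0; rewrite -ey y0 oppr0.
    by rewrite -ey; split; field; nonzero.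
  have dx : x2 - x1 != 0 by rewrite subr_eq0 eq_sym.
  split; last by rewrite divfK //; ring.
  set s' := _ / _.
  have hs' : s' * (x2 - x1) = y2 - y1 by rewrite divfK.
  apply: (mulfI dx); rewrite mulr0.
  transitivity ((x2 ^+ 3 + n * a * x2 ^+ 2 + - n ^+ 2 * x2 + 0)
     - (x1 ^+ 3 + n * a * x1 ^+ 2 + - n ^+ 2 * x1 + 0)
     - (s' * (x2 - x1)) ^+ 2 - 2 * (s' * (x2 - x1)) * y1); first by ring.
  by rewrite -h1 -h2 hs'; ring.
have {hs} [hs ey2] := hs.
set x3 := s ^+ 2 - n * a - x1 - x2.
have c1 : x1 * x2 + x2 * x3 + x3 * x1 + n ^+ 2 = - (2 * s * (y1 - s * x1)).
  by apply/eqP; rewrite -subr_eq0; apply/eqP; rewrite -[RHS]oppr0 -hs /x3; ring.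
have c0 : (y1 - s * x1) ^+ 2 = x1 * x2 * x3.
  transitivity (y1 ^+ 2 + - (2 * s * (y1 - s * x1)) * x1 - s ^+ 2 * x1 ^+ 2).
    by ring.
  by rewrite h1 -c1 /x3; ring.
rewrite (_ : s * (x1 - x3) - y1 = - (s * (x3 - x1) + y1)); last by ring.
rewrite /= mulNr maninN; apply/eqP; rewrite eq_sym -addr_eq0; apply/eqP.
rewrite -[RHS](@manin_line (x1 / n) (x2 / n) (x3 / n) s ((y1 - s * x1) / n)).
- by rewrite ey2; congr (manin _ _ _ _ + manin _ _ _ _ + manin _ _ _ _); field.
- by rewrite expr_div_n c0; field.
- transitivity ((n ^+ 2 + x1 * x2 + x2 * x3 + x3 * x1) / n); first by field.
  rewrite (_ : n ^+ 2 + x1 * x2 + x2 * x3 + x3 * x1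
             = x1 * x2 + x2 * x3 + x3 * x1 + n ^+ 2); last by ring.
  by rewrite c1; field.
- by rewrite /x3; field.
Qed.
End Manin.

(** * The derivation d/du of a field of rational functions *)

(** The quotient rule stated for independent field elements, to keep the field
    of fractions out of the computations. *)
Section QuotientRule.
Variable K : fieldType.
Implicit Types a b c d : K.

Lemma quotient_rule_wd a b a' b' c d c' d' :
  b != 0 -> d != 0 -> c * b = a * d -> c' * b + c * b' = a' * d + a * d' ->
  (a' * b - a * b') / b ^+ 2 = (c' * d - c * d') / d ^+ 2.
Proof.
move=> b0 d0 e e'; apply/eqP; rewrite eqr_div ?expf_neq0 //; apply/eqP.
transitivity (b * d * (a' * d + a * d') - b * d' * (a * d) - b' * d * (a * d)).
  by ring.
by rewrite -e' -e; ring.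
Qed.

Lemma quotient_ruleD a b a' b' c d c' d' : b != 0 -> d != 0 ->
  ((a' * d + a * d' + (c' * b + c * b')) * (b * d)
   - (a * d + c * b) * (b' * d + b * d')) / (b * d) ^+ 2
  = (a' * b - a * b') / b ^+ 2 + (c' * d - c * d') / d ^+ 2.
Proof. by move=> b0 d0; field; nonzero. Qed.

Lemma quotient_ruleM a b a' b' c d c' d' : b != 0 -> d != 0 ->
  ((a' * c + a * c') * (b * d) - (a * c) * (b' * d + b * d')) / (b * d) ^+ 2
  = (a' * b - a * b') / b ^+ 2 * (c / d) + a / b * ((c' * d - c * d') / d ^+ 2).
Proof. by move=> b0 d0; field; nonzero. Qed.
End QuotientRule.

Section FractionDerivation.
Variable F : fieldType.
Local Notation R := {poly F}.

Lemma frac_repr (z : {fraction R}) :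
  z = tofrac \n_(repr z) / tofrac \d_(repr z).
Proof.
apply: (mulIf (x := tofrac \d_(repr z))); first by rewrite tofrac_eq0 denom_ratioP.
rewrite divfK ?tofrac_eq0 ?denom_ratioP // -{1}[z]reprK.
unlock tofrac; rewrite -[LHS]FracField.pi_mul /FracField.mulf.
rewrite !numden_Ratio ?oner_neq0 // mulr1.
apply/eqmodP; rewrite /= FracField.equivfE.
rewrite !numden_Ratio ?mulf_neq0 ?oner_neq0 ?denom_ratioP //.
by rewrite mulr1 mulrC.
Qed.

Definition frac_deriv (z : {fraction R}) : {fraction R} :=
  let a := \n_(repr z) in let b := \d_(repr z) in
  (tofrac a^`() * tofrac b - tofrac a * tofrac b^`()) / tofrac b ^+ 2.

Lemma frac_deriv_div (a b : R) : b != 0 ->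
  frac_deriv (tofrac a / tofrac b)
  = (tofrac a^`() * tofrac b - tofrac a * tofrac b^`()) / tofrac b ^+ 2.
Proof.
move=> b0; rewrite /frac_deriv; set z := tofrac a / tofrac b.
have := frac_repr z; set p := \n_(repr z); set q := \d_(repr z) => ez.
have q0 : q != 0 by exact: denom_ratioP.
have E : a * q = p * b.
  by apply/eqP; rewrite -tofrac_eq !tofracM -eqr_div ?tofrac_eq0 // -ez.
apply: quotient_rule_wd; rewrite ?tofrac_eq0 // -!tofracM ?E // -!tofracD.
by congr tofrac; rewrite -!derivM E.
Qed.

Lemma frac_deriv_tofrac (a : R) : frac_deriv (tofrac a) = tofrac a^`().
Proof.
rewrite -[tofrac a]divr1 -tofrac1 frac_deriv_div ?oner_neq0 //.
by rewrite tofrac1 derivC tofrac0 mulr0 subr0 mulr1 expr1n divr1.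
Qed.

Lemma derivation_frac_deriv : derivation frac_deriv.
Proof.
split=> x y; rewrite (frac_repr x) (frac_repr y).
  rewrite addf_div ?tofrac_eq0 ?denom_ratioP // -!tofracM -tofracD.
  rewrite !frac_deriv_div ?mulf_neq0 ?denom_ratioP // derivD !derivM.
  rewrite !(tofracD, tofracM).
  by apply: quotient_ruleD; rewrite tofrac_eq0 denom_ratioP.
rewrite mulf_div -!tofracM.
rewrite !frac_deriv_div ?mulf_neq0 ?denom_ratioP // !derivM !(tofracD, tofracM).
by apply: quotient_ruleM; rewrite tofrac_eq0 denom_ratioP.
Qed.
End FractionDerivation.

(** * Reduction at a place of the field of fractions *)

Section Reduction.
Variables (R : comNzRingType) (K F : fieldType).
Variables (i : {rmorphism R -> K}) (ev : {rmorphism R -> F}).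
Hypothesis i_inj : injective i.

(** The fraction z lies in the local ring of the place given by ev, and its
    residue there is c. *)
Definition red (z : K) (c : F) : Prop :=
  exists a b, [/\ ev b != 0, z * i b = i a & ev a = c * ev b].

Lemma red_ring a : red (i a) (ev a).
Proof. by exists a, 1; rewrite !rmorph1 !mulr1 oner_neq0. Qed.

Lemma red_nat k : red k%:R k%:R.
Proof. by rewrite -(rmorph_nat i) -(rmorph_nat ev); apply: red_ring. Qed.

Lemma redD x y c d : red x c -> red y d -> red (x + y) (c + d).
Proof.
move=> [a [b [b0 xb ac]]] [a' [b' [b0' xb' ac']]].
exists (a * b' + a' * b), (b * b'); rewrite !(rmorphD, rmorphM) /= mulf_neq0 //.
by split=> //; [rewrite -xb -xb' | rewrite ac ac']; ring.
Qed.

Lemma redM x y c d : red x c -> red y d -> red (x * y) (c * d).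
Proof.
move=> [a [b [b0 xb ac]]] [a' [b' [b0' xb' ac']]].
exists (a * a'), (b * b'); rewrite !rmorphM /= mulf_neq0 //.
by split=> //; [rewrite -xb -xb' | rewrite ac ac']; ring.
Qed.

Lemma redN x c : red x c -> red (- x) (- c).
Proof.
move=> [a [b [b0 xb ac]]]; exists (- a), b.
by rewrite !rmorphN b0 !mulNr xb ac.
Qed.

Lemma red0_eq0 c : red 0 c -> c = 0.
Proof.
move=> [a [b [b0]]]; rewrite mul0r -(rmorph0 i) => /i_inj <-.
by rewrite rmorph0 => /esym/eqP; rewrite mulf_eq0 (negPf b0) orbF => /eqP.
Qed.

Lemma red_neq0 x c : red x c -> c != 0 -> x != 0.
Proof. by move=> xc; apply: contra_neq => x0; apply: red0_eq0; rewrite -x0. Qed.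

Lemma redV x c : c != 0 -> red x c -> red x^-1 c^-1.
Proof.
move=> c0 xc; have x0 := red_neq0 xc c0.
case: xc => [a [b [b0 xb ac]]]; exists b, a.
split; [by rewrite ac mulf_neq0 | by rewrite -xb mulKf | by rewrite ac mulKf].
Qed.

Lemma redXn x c k : red x c -> red (x ^+ k) (c ^+ k).
Proof.
move=> xc; elim: k => [|k IH]; first exact: (red_nat 1).
by rewrite !exprS; apply: redM.
Qed.

Variable D : K -> K.
Hypothesis derD : derivation D.

(** The residues of z and of its first two derivatives.  Jets can be computed
    along rational operations, by the Leibniz rule of order two. *)
Definition jet (z : K) (j : F * F * F) : Prop :=
  [/\ red z j.1.1, red (D z) j.1.2 & red (D (D z)) j.2].

Definition jetD (j k : F * F * F) := (j.1.1 + k.1.1, j.1.2 + k.1.2, j.2 + k.2).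
Definition jetN (j : F * F * F) := (- j.1.1, - j.1.2, - j.2).
Definition jetM (j k : F * F * F) :=
  (j.1.1 * k.1.1, j.1.2 * k.1.1 + j.1.1 * k.1.2,
   j.2 * k.1.1 + 2 * (j.1.2 * k.1.2) + j.1.1 * k.2).
Definition jetV (j : F * F * F) :=
  let r := j.1.1^-1 in
  (r, - (j.1.2 * r ^+ 2), 2 * j.1.2 ^+ 2 * r ^+ 3 - j.2 * r ^+ 2).

Lemma jet_nat k : jet k%:R (k%:R, 0, 0).
Proof.
split; rewrite ?(der_nat derD) ?(der0 derD) //=; first exact: red_nat.
- exact: (red_nat 0).
- exact: (red_nat 0).
Qed.

Lemma jet_add x y j k : jet x j -> jet y k -> jet (x + y) (jetD j k).
Proof. by case=> ? ? ? [? ? ?]; split; rewrite /= ?(der_add derD); apply: redD. Qed.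

Lemma jet_opp x j : jet x j -> jet (- x) (jetN j).
Proof. by case=> ? ? ?; split; rewrite /= ?(der_opp derD); apply: redN. Qed.

Lemma jet_mul x y j k : jet x j -> jet y k -> jet (x * y) (jetM j k).
Proof.
case=> x0 x1 x2 [y0 y1 y2]; split; rewrite /= ?(der_mul derD).
- exact: redM.
- by apply: redD; apply: redM.
rewrite !(der_add derD, der_mul derD).
have -> : D (D x) * y + D x * D y + (D x * D y + x * D (D y))
          = D (D x) * y + 2%:R * (D x * D y) + x * D (D y) by ring.
by do 2?[apply: redD]; do ?[apply: redM] => //; apply: red_nat.
Qed.

Lemma jet_inv x j : j.1.1 != 0 -> jet x j -> jet x^-1 (jetV j).
Proof.
move=> j0 [x0 x1 x2]; have nx := red_neq0 x0 j0.
have rV := redV j0 x0.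
have eD : D x^-1 = - (D x * x^-1 ^+ 2) by rewrite (der_inv derD) // exprVn.
split; rewrite //= eD.
  by apply: redN; apply: redM => //; apply: redXn.
rewrite (der_opp derD) (der_mul derD) (der_exp derD) eD.
have -> : - (D (D x) * x^-1 ^+ 2 + D x * (2%:R * x^-1 ^+ 1 * - (D x * x^-1 ^+ 2)))
   = 2%:R * D x ^+ 2 * x^-1 ^+ 3 - D (D x) * x^-1 ^+ 2 by ring.
apply: redD; last by apply: redN; apply: redM => //; apply: redXn.
by apply: redM; [apply: redM; [exact: red_nat | exact: redXn] | exact: redXn].
Qed.
End Reduction.

(** * Rational expressions and the computation of their jets *)

(** Reified expressions, so that one formula denotes a rational function and
    also computes its residues in a finite field. *)
Inductive expr :=
  | EVar of nat | ENat of nat | EAdd of expr & expr | EOpp of expr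
  | EMul of expr & expr | EInv of expr | EPow of expr & nat.

Fixpoint interp (K : fieldType) (env : seq K) (e : expr) : K :=
  match e with
  | EVar k => env`_k
  | ENat k => k%:R
  | EAdd e1 e2 => interp env e1 + interp env e2
  | EOpp e1 => - interp env e1
  | EMul e1 e2 => interp env e1 * interp env e2
  | EInv e1 => (interp env e1)^-1
  | EPow e1 k => interp env e1 ^+ k
  end.

Section Jets.
Variables (R : comNzRingType) (K F : fieldType).
Variables (i : {rmorphism R -> K}) (ev : {rmorphism R -> F}).
Hypothesis i_inj : injective i.
Variable D : K -> K.
Hypothesis derD : derivation D.
Local Notation jet := (jet i ev D).

(** None signals a division by an element whose residue is 0. *)
Fixpoint jeval (env : seq (F * F * F)) (e : expr) : option (F * F * F) :=
  match e with
  | EVar k => Some (nth (0, 0, 0) env k)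
  | ENat k => Some (k%:R, 0, 0)
  | EAdd e1 e2 =>
      if jeval env e1 is Some j then
        if jeval env e2 is Some k then Some (jetD j k) else None
      else None
  | EOpp e1 => omap (@jetN F) (jeval env e1)
  | EMul e1 e2 =>
      if jeval env e1 is Some j then
        if jeval env e2 is Some k then Some (jetM j k) else None
      else None
  | EInv e1 =>
      if jeval env e1 is Some j then
        if j.1.1 == 0 then None else Some (jetV j)
      else None
  | EPow e1 k => omap (fun j => iter k (jetM j) (1, 0, 0)) (jeval env e1)
  end.

Definition jet_env (env : seq K) (jenv : seq (F * F * F)) : Prop :=
  forall k, jet env`_k (nth (0, 0, 0) jenv k).

Lemma jet_env_nil : jet_env [::] [::].
Proof. by move=> k; rewrite !nth_nil; exact: (jet_nat i ev derD 0). Qed.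

Lemma jet_env_cons z j env jenv :
  jet z j -> jet_env env jenv -> jet_env (z :: env) (j :: jenv).
Proof. by move=> h H [|k] /=. Qed.

Lemma jevalP env jenv e j :
  jet_env env jenv -> jeval jenv e = Some j -> jet (interp env e) j.
Proof.
move=> H; elim: e j => [k|k|e1 IH1 e2 IH2|e1 IH1|e1 IH1 e2 IH2|e1 IH1|e1 IH1 k] j /=.
- by move=> [<-]; apply: H.
- by move=> [<-]; apply: jet_nat.
- case: jeval IH1 => // j1 IH1; case: jeval IH2 => // j2 IH2 [<-].
  by apply: jet_add; [exact: derD | exact: IH1 | exact: IH2].
- case: jeval IH1 => // j1 IH1 [<-].
  by apply: jet_opp; [exact: derD | exact: IH1].
- case: jeval IH1 => // j1 IH1; case: jeval IH2 => // j2 IH2 [<-].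
  by apply: jet_mul; [exact: derD | exact: IH1 | exact: IH2].
- case: jeval IH1 => // j1 IH1; case: eqVneq => // j0 [<-].
  by apply: jet_inv => //; exact: IH1.
case: jeval IH1 => // j1 IH1 [<-]; elim: k => [|k IH] /=.
  by rewrite expr0; apply: (jet_nat i ev derD 1).
by rewrite exprS; apply: jet_mul; [exact: derD | exact: IH1 | exact: IH].
Qed.

(** The residue of [manin], after expansion of its second-order derivative; it
    only depends on the jets of the four arguments. *)
Definition manin_jet (n a X Y : F * F * F) : option F :=
  if [&& Y.1.1 != 0, a.1.2 != 0, n.1.1 != 0 & (2 : F) != 0] then
    let v := Y.1.1^-1 in let b := a.1.2^-1 in
    let p := X.1.2 * v in
    Some ((a.1.1 ^+ 2 + 4)
          * (X.2 * v * b - p * Y.1.2 * v * b - p * a.2 * b ^+ 2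
             + n.1.2 * (2 * n.1.1)^-1 * (p * b)
             - n.1.1 * X.1.1 ^+ 2 * X.1.2 * (2 * Y.1.1 ^+ 3)^-1)
          + 2 * a.1.1 * p
          - n.1.1 * a.1.2 * (X.1.1 ^+ 2 * (X.1.1 ^+ 2 + 1)) * (2 * Y.1.1 ^+ 3)^-1)
  else None.

Lemma manin_jetP (n a X Y : K) jn ja jX jY c :
  jet n jn -> jet a ja -> jet X jX -> jet Y jY ->
  manin_jet jn ja jX jY = Some c -> red i ev (manin D n a X Y) c.
Proof.
move=> [n0 n1 n2] [a0 a1 a2] [X0 X1 X2] [Y0 Y1 Y2].
rewrite /manin_jet; case: ifP => // /and4P[hY hA hn h2] [<-].
have r2 : red i ev 2%:R 2%:R by exact: red_nat.
have rV := redV i_inj hY Y0; have rb := redV i_inj hA a1.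
have nY := red_neq0 i_inj Y0 hY; have nA := red_neq0 i_inj a1 hA.
have -> : manin D n a X Y = (a ^+ 2 + 4%:R)
          * (D (D X) * Y^-1 * (D a)^-1 - D X * Y^-1 * D Y * Y^-1 * (D a)^-1
             - D X * Y^-1 * D (D a) * (D a)^-1 ^+ 2
             + D n * (2%:R * n)^-1 * (D X * Y^-1 * (D a)^-1)
             - n * X ^+ 2 * D X * (2%:R * Y ^+ 3)^-1)
          + 2%:R * a * (D X * Y^-1)
          - n * D a * (X ^+ 2 * (X ^+ 2 + 1)) * (2%:R * Y ^+ 3)^-1.
  have hn' := red_neq0 i_inj n0 hn; have h2' := red_neq0 i_inj r2 h2.
  by rewrite /manin !(der_div derD) //; field; nonzero.
have r1 : red i ev 1 1 by exact: (red_nat _ _ 1).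
have r2n : red i ev (2%:R * n)^-1 (2%:R * jn.1.1)^-1.
  by apply: redV => //; [apply: mulf_neq0 | apply: redM].
have rY3 : red i ev (2%:R * Y ^+ 3)^-1 (2%:R * jY.1.1 ^+ 3)^-1.
  apply: redV => //; first by rewrite mulf_neq0 // expf_neq0.
  by apply: redM => //; apply: redXn.
by do ![exact: red_nat | assumption | apply: redD | apply: redN | apply: redXn | apply: redM].
Qed.
End Jets.

(** * The family and its five points *)

Declare Scope expr_scope.
Delimit Scope expr_scope with expr.
Bind Scope expr_scope with expr.
Notation "x + y" := (EAdd x y) : expr_scope.
Notation "- x" := (EOpp x) : expr_scope.
Notation "x - y" := (EAdd x (EOpp y)) : expr_scope.
Notation "x * y" := (EMul x y) : expr_scope.
Notation "x / y" := (EMul x (EInv y)) : expr_scope.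
Notation "x ^+ k" := (EPow x k) : expr_scope.
Coercion ENat : nat >-> expr.

Fixpoint horner_expr (s : seq expr) (x : expr) : expr :=
  if s is c :: s' then (c + x * horner_expr s' x)%expr else ENat 0.

Local Open Scope expr_scope.

(** The environment lists u, w, r and s; the last three are themselves expressions
    in u, evaluated in the environment of length one.  Coefficients of
    polynomials in v = (u - 1)^2 are listed from degree 0. *)
Definition Eu := EVar 0.
Definition Ev := (Eu - 1%N) ^+ 2.
Definition coefs_A : seq expr :=
  [:: ENat 2; ENat 24; ENat 63; - 138%N; - 635%N; - 852%N; - 415%N; - 90%N; - 7%N].
Definition coefs_S : seq expr := map ENat [:: 2; 30; 225; 1029; 2345; 2325; 1459; 639; 129; 9]%N.
Definition EA := horner_expr coefs_A Ev.
Definition EB := horner_expr (rev coefs_A) Ev.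
Definition Ew := EA / ((Eu - 1%N) * EB).
Definition Er := horner_expr (rev coefs_S) Ev / EB.
Definition Es := horner_expr coefs_S Ev / ((Eu - 1%N) * EB).

(** From here on w, r and s are variables: sharing them keeps the expressions
    small. *)
Definition Vw := EVar 1.
Definition Vr := EVar 2.
Definition Vs := EVar 3.
Definition Et := Eu - 1%N.
Definition Ealpha := 4%N * Et ^+ 2 * (Vw ^+ 2 + 1%N) ^+ 2 + Vw ^+ 2 * Eu ^+ 2 * (Eu - 2%N) ^+ 2.
Definition En := (Vw ^+ 4 - 1%N) * Eu * (Eu - 2%N) * Et.
Definition EC := (Vw ^+ 4 - 1%N) * Eu ^+ 2 * Et.
Definition Epoints : seq (expr * expr) :=
  [:: (- ((Vw - 1%N) ^+ 2 * (Vw + 1%N) ^+ 2 * Eu ^+ 2 * Et),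
         (Vw ^+ 2 - 1%N) ^+ 2 * Eu ^+ 4 * Et * Vw);
      (- (Eu ^+ 2 * Vw ^+ 2 * (Eu - 2%N) ^+ 2),
         Eu ^+ 2 * Vw * (Eu - 2%N) ^+ 2 * Et * (Vw ^+ 2 + 1%N) ^+ 2);
      (- (4%N * (Vw ^+ 2 + 1%N) ^+ 2 * Et ^+ 2),
         2%N * (Vw ^+ 2 + 1%N) ^+ 3 * Et ^+ 2 * Eu * (Eu - 2%N));
      (EC, EC * Vw * Vr);
      (- (Eu ^+ 2 * Et * (Vw ^+ 4 - 1%N)), EC * Vs)].

(** The discriminant of the curve is 16 n^4 times this factor. *)
Definition Edisc := (Ealpha ^+ 2 + 4%N * En ^+ 2).

Local Close Scope expr_scope.

Section Values.
Variables (R : comNzRingType) (K F : fieldType).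
Variables (i : {rmorphism R -> K}) (ev : {rmorphism R -> F}).
Hypothesis i_inj : injective i.
Variable D : K -> K.
Hypothesis derD : derivation D.

(** Jets of u, w, r and s at u = u0, for a derivation with derivative 1 at u. *)
Definition jets_at (u0 : F) : option (seq (F * F * F)) :=
  let ju := (u0, 1, 0) in
  if (jeval [:: ju] Ew, jeval [:: ju] Er, jeval [:: ju] Es) is (Some jw, Some jr, Some js)
  then Some [:: ju; jw; jr; js] else None.

Definition env_of (u : K) : seq K := [:: u; interp [:: u] Ew; interp [:: u] Er; interp [:: u] Es].

Lemma jets_atP u u0 env : red i ev u u0 -> D u = 1 ->
  jets_at u0 = Some env -> jet_env i ev D (env_of u) env.
Proof.
move=> r0 Du; have ju : jet i ev D u (u0, 1, 0).
  split; rewrite //= Du ?(der1 derD); [exact: (red_nat i ev 1)|exact: (red_nat i ev 0)].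
have jnil := jet_env_nil i ev derD; have jue := jet_env_cons ju jnil.
have H e j : jeval [:: (u0, 1, 0)] e = Some j -> jet i ev D (interp [:: u] e) j.
  exact: jevalP.
rewrite /jets_at; case E1: (jeval _ Ew) => [jw|] //; case E2: (jeval _ Er) => [jr|] //.
case E3: (jeval _ Es) => [js|] // [<-].
by do ![apply: jet_env_cons; first by [|apply: H]].
Qed.

Definition jet_of (u0 : F) (e : expr) : option (F * F * F) :=
  obind (fun env => jeval env e) (jets_at u0).

Lemma jet_ofP u u0 e j : red i ev u u0 -> D u = 1 ->
  jet_of u0 e = Some j -> jet i ev D (interp (env_of u) e) j.
Proof.
move=> ru Du; rewrite /jet_of; case E: (jets_at u0) => [jenv|] //= Ee.
exact: (jevalP i_inj derD (jets_atP ru Du E) Ee).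
Qed.

Definition manin_value_at (u0 : F) (p : expr * expr) : option F :=
  if (jet_of u0 En, jet_of u0 (EMul Ealpha (EInv En)),
      jet_of u0 (EMul p.1 (EInv En)), jet_of u0 (EMul p.2 (EInv En)))
    is (Some jn, Some ja, Some jX, Some jY)
  then manin_jet jn ja jX jY else None.

Definition neq0_at (u0 : F) (e : expr) : bool :=
  oapp (fun j => j.1.1 != 0) false (jet_of u0 e).
Definition der_neq0_at (u0 : F) (e : expr) : bool :=
  oapp (fun j => j.1.2 != 0) false (jet_of u0 e).

Section At.
Variables (u : K) (u0 : F).
Hypotheses (ru : red i ev u u0) (Du : D u = 1).

Lemma manin_value_atP p c : manin_value_at u0 p = Some c ->
  let env := env_of u in
  let n := interp env En in
  red i ev (manin D n (interp env Ealpha / n) (interp env p.1 / n) (interp env p.2 / n)) c.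
Proof.
rewrite /manin_value_at; case E1: (jet_of u0 En) => [jn|] //.
case E2: (jet_of u0 (EMul Ealpha _)) => [ja|] //.
case E3: (jet_of u0 (EMul p.1 _)) => [jX|] //.
case E4: (jet_of u0 (EMul p.2 _)) => [jY|] // h.
exact: (manin_jetP i_inj derD (jet_ofP ru Du E1) (jet_ofP ru Du E2)
                   (jet_ofP ru Du E3) (jet_ofP ru Du E4) h).
Qed.

Lemma neq0_atP e : neq0_at u0 e -> interp (env_of u) e != 0.
Proof.
rewrite /neq0_at; case E: (jet_of u0 e) => [j|] //= j0.
by have [h _ _] := jet_ofP ru Du E; apply: red_neq0 h j0.
Qed.

Lemma der_neq0_atP e : der_neq0_at u0 e -> D (interp (env_of u) e) != 0.
Proof.
rewrite /der_neq0_at; case E: (jet_of u0 e) => [j|] //= j0.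
by have [_ h _] := jet_ofP ru Du E; apply: red_neq0 h j0.
Qed.
End At.
End Values.

Section Curve.
Variable K : fieldType.
Implicit Types u w r s : K.

(** In terms of t = u - 1, m is - 4 t N / (q d^2) with N, q and d even in t; then
    A = 2 N^2 - q^2 d^2 N + q^2 d^4 and B = 2 N^2 - q^2 d^4. *)
Lemma w_of_m u : (2 : K) != 0 -> u - 1 != 0 -> u ^+ 2 - 2 * u + 4 != 0 ->
  3 * u ^+ 2 - 6 * u + 4 != 0 -> interp [:: u] EB != 0 ->
  let m := - (4 * (u - 1)
              * (u ^+ 8 - 8 * u ^+ 7 + 34 * u ^+ 6 - 92 * u ^+ 5
                 + 178 * u ^+ 4 - 248 * u ^+ 3 + 232 * u ^+ 2
                 - 128 * u + 32))
           / ((u ^+ 2 - 2 * u + 4) * (3 * u ^+ 2 - 6 * u + 4) ^+ 2) in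
  (m ^+ 2 + 2 * (u - 1) * (u ^+ 2 - 2 * u + 4) * m + 8 * (u - 1) ^+ 2)
           / ((u - 1) * m ^+ 2 - 8 * (u - 1) ^+ 3) = interp [:: u] Ew.
Proof.
move=> h2 hu hq hD hB m.
pose t := u - 1; pose v := t ^+ 2.
pose N := 1 + 6 * v + 18 * v ^+ 2 + 6 * v ^+ 3 + v ^+ 4.
pose q := v + 3; pose d := 3 * v + 1.
have eq : u ^+ 2 - 2 * u + 4 = q by rewrite /q /v /t; ring.
have ed : 3 * u ^+ 2 - 6 * u + 4 = d by rewrite /d /v /t; ring.
have em : m = - (4 * t * N) / (q * d ^+ 2).
  by rewrite /m -eq -ed; congr (- _ / _); rewrite /N /v /t; ring.
rewrite eq ed -/t in hu hq hD *.
have eA : interp [:: u] EA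
   = 2 * N ^+ 2 - q ^+ 2 * d ^+ 2 * N + q ^+ 2 * d ^+ 4.
  by rewrite /= -/t -/v /N /q /d; ring.
have eB : interp [:: u] EB = 2 * N ^+ 2 - q ^+ 2 * d ^+ 4.
  by rewrite /= -/t -/v /N /q /d; ring.
have -> : interp [:: u] Ew = interp [:: u] EA / (t * interp [:: u] EB) by [].
rewrite em.
have h8 : (8 : K) != 0 by rewrite (_ : 8 = 2 * (2 * 2)); [nonzero | ring].
have hB' : 2 * N ^+ 2 - q ^+ 2 * d ^+ 4 != 0 by rewrite -eB.
rewrite eA eB.
(* the denominator of w, cleared of q d^2, is a multiple of t^3 B *)
have h3 : t * (- (4 * t * N)) ^+ 2 + - (8 * t ^+ 3) * (q ^+ 2 * d ^+ 4) != 0.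
  rewrite (_ : _ + _ = 8 * t ^+ 3 * (2 * N ^+ 2 - q ^+ 2 * d ^+ 4)); last by ring.
  by rewrite !mulf_neq0 // expf_neq0.
by field; nonzero.
Qed.

Section Square.
Variable u : K.
Hypotheses (u1 : u - 1 != 0) (B0 : interp [:: u] EB != 0).
Let w := interp [:: u] Ew.

Lemma square_r :
  interp [:: u] Er ^+ 2 = 8 * (u - 1) ^+ 2 * (w ^+ 2 + 1) + u ^+ 2 * (u - 2) ^+ 2.
Proof.
have -> : w = interp [:: u] EA / ((u - 1) * interp [:: u] EB) by [].
have -> : interp [:: u] Er = interp [:: u] (horner_expr (rev coefs_S) Ev) / interp [:: u] EB by [].
have E : interp [:: u] (horner_expr (rev coefs_S) Ev) ^+ 2
   = 8 * interp [:: u] EA ^+ 2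
     + (8 * (u - 1) ^+ 2 + u ^+ 2 * (u - 2) ^+ 2) * interp [:: u] EB ^+ 2.
  by rewrite /=; ring.
move: (interp _ EB) (interp _ EA) B0 E => B A b0 E.
by rewrite exprMn E; field; nonzero.
Qed.

Lemma square_s :
  interp [:: u] Es ^+ 2 = 8 * (u - 1) ^+ 2 * (w ^+ 2 + 1) + w ^+ 2 * u ^+ 2 * (u - 2) ^+ 2.
Proof.
have -> : w = interp [:: u] EA / ((u - 1) * interp [:: u] EB) by [].
have -> : interp [:: u] Es
  = interp [:: u] (horner_expr coefs_S Ev) / ((u - 1) * interp [:: u] EB) by [].
have E : interp [:: u] (horner_expr coefs_S Ev) ^+ 2
   = (8 * (u - 1) ^+ 2 + u ^+ 2 * (u - 2) ^+ 2) * interp [:: u] EA ^+ 2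
     + 8 * (u - 1) ^+ 4 * interp [:: u] EB ^+ 2.
  by rewrite /=; ring.
move: (interp _ EB) (interp _ EA) B0 E => B A b0 E.
by rewrite exprMn E; field; nonzero.
Qed.

(** The values of the cubic at x4 and x5 contain r^2 and s^2; at x1, x2, x3 the
    ordinate is a polynomial in u and w. *)
Lemma points_on_curve k (E : cubic K) : (k < 5)%N ->
  let env := env_of u in
  a2 E = interp env Ealpha -> a4 E = - interp env En ^+ 2 -> a6 E = 0 ->
  let p := nth (ENat 0, ENat 0) Epoints k in
  on_curve E (Affine (interp env p.1) (interp env p.2)).
Proof.
move=> hk env E2 E4 E6; rewrite /= E2 E4 E6; apply/eqP.
have := square_r; have := square_s; rewrite /env /env_of -/w.
move: w (interp [:: u] Er) (interp [:: u] Es) => W r s es er.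
move: k hk => [|[|[|[|[|//]]]]] _ /=.
- by ring.
- by ring.
- by ring.
- by rewrite exprMn er; ring.
- by rewrite exprMn es; ring.
Qed.
End Square.
End Curve.

(** * From relations between points to relations between their images *)

Section MordellWeilHom.
Variables (K : fieldType) (E : cubic K) (f : mw_point E -> K).
Hypotheses (f_add : {morph f : P Q / mw_add P Q >-> P + Q})
  (f_opp : {morph f : P / mw_opp P >-> - P}) (f_zero : f (mw_zero E) = 0).

Lemma hom_mulz P c : f (mw_mulz P c) = c%:~R * f P.
Proof.
have H k : f (iter k (mw_add P) (mw_zero E)) = k%:R * f P.
  by elim: k => [|k IH]; rewrite ?f_zero ?mul0r // iterS f_add IH -nat1r mulrDl mul1r.
case: c => k; first exact: H.
by rewrite [mw_mulz _ _]/(mw_opp (iter k.+1 (mw_add P) (mw_zero E))) f_opp H NegzE rmorphN mulNr.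
Qed.

Lemma hom_sum r (P : 'I_r -> mw_point E) (c : 'I_r -> int) :
  f (\big[@mw_add K E/mw_zero E]_(i < r) mw_mulz (P i) (c i)) = \sum_(i < r) (c i)%:~R * f (P i).
Proof. by rewrite (big_morph f f_add f_zero); apply: eq_bigr => i _; apply: hom_mulz. Qed.
End MordellWeilHom.

(** Infinite descent: if p divides all coefficients of every relation, dividing
    by p gives a relation again, so every power of p divides them. *)
Lemma relation_descent (V : zmodType) (p r : nat) (M : 'I_r -> V) :
  (1 < p)%N -> (forall x : V, x *+ p = 0 -> x = 0) ->
  (forall c : 'I_r -> int, \sum_(i < r) M i *~ c i = 0 -> forall i, (p %| c i)%Z) ->
  forall c : 'I_r -> int, \sum_(i < r) M i *~ c i = 0 -> forall i, c i = 0.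
Proof.
move=> p1 tf H c hc i.
have div k : forall c : 'I_r -> int, \sum_(i < r) M i *~ c i = 0 ->
    forall i, ((p ^ k)%:Z %| c i)%Z.
  elim: k => [|k IH] {hc}c hc j; first by rewrite expn0 dvd1z.
  have hd := H c hc; pose d l := (c l %/ p)%Z.
  have cd l : c l = d l * p by rewrite divzK.
  have hs : \sum_(i < r) M i *~ d i = 0.
    apply: tf; rewrite -sumrMnl -[RHS]hc; apply: eq_bigr => l _.
    by rewrite cd mulrzA pmulrn.
  rewrite cd expnSr PoszM; apply: dvdz_mul; [exact: IH | exact: dvdzz].
have := div `|c i|%N c hc i; rewrite dvdzE /= => hdiv.
apply/eqP; rewrite -absz_eq0; apply: contraTT hdiv; rewrite -lt0n => c0.
by apply/negP => /(dvdn_leq c0); rewrite leqNgt ltn_expl.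
Qed.

(** * Independence of the images, modulo 11 *)

Definition intpoly_frac : {poly int} -> ratfun := @tofrac {poly rat} \o map_poly intr.
HB.instance Definition _ := GRing.RMorphism.on intpoly_frac.

Lemma intpoly_frac_inj : injective intpoly_frac.
Proof.
move=> a b /eqP; rewrite /intpoly_frac /= tofrac_eq => /eqP.
exact: (map_inj_poly (@intr_inj _) (rmorph0 _)).
Qed.

Definition eval_mod11 (u0 : 'F_11) : {poly int} -> 'F_11 := horner_eval u0 \o map_poly intr.
HB.instance Definition _ u0 := GRing.RMorphism.on (eval_mod11 u0).

Definition gen_u : ratfun := tofrac ('X : {poly rat}).
Local Notation ddu := (@frac_deriv rat).

Lemma der_gen_u : ddu gen_u = 1.
Proof. by rewrite frac_deriv_tofrac derivX tofrac1. Qed.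

Lemma red_gen_u u0 : red intpoly_frac (eval_mod11 u0) gen_u u0.
Proof.
have eX : intpoly_frac 'X = gen_u by rewrite /intpoly_frac /= map_polyX.
have ev : eval_mod11 u0 'X = u0 by rewrite /eval_mod11 /= map_polyX /horner_eval hornerX.
have : red intpoly_frac (eval_mod11 u0) (intpoly_frac 'X) (eval_mod11 u0 'X) by exact: red_ring.
by rewrite eX ev.
Qed.

Local Notation env := (env_of gen_u).

Definition twist_n := interp env En.
Definition twist_a := interp env Ealpha / twist_n.
Definition gen_coords (i : 'I_5) := nth (ENat 0, ENat 0) Epoints i.
Definition manin_gen (i : 'I_5) : ratfun :=
  manin ddu twist_n twist_a (interp env (gen_coords i).1 / twist_n)
    (interp env (gen_coords i).2 / twist_n).

(** The images of the five points modulo 11; row j is for u = j + 3. *)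
Definition manin_rows : seq (seq nat) :=
  [:: [:: 1; 2; 10; 5; 7]; [:: 8; 8; 0; 1; 4]; [:: 9; 9; 0; 1; 3];
      [:: 5; 4; 2; 8; 1]; [:: 2; 4; 2; 8; 1]]%N.

(** Compared in nat: the normal form of an element of the prime field would
    carry a large proof term. *)
Lemma manin_mod11 (i j : 'I_5) :
  omap (@nat_of_ord _) (manin_value_at ((j + 3)%:R : 'F_11) (gen_coords i))
  = Some (nth 0%N (nth [::] manin_rows j) i).
Proof.
by case: i => [[|[|[|[|[|//]]]]] ?]; case: j => [[|[|[|[|[|//]]]]] ?]; vm_compute.
Qed.

Lemma red_manin_gen (i j : 'I_5) :
  red intpoly_frac (eval_mod11 (j + 3)%:R) (manin_gen i) (nth 0%N (nth [::] manin_rows j) i)%:R.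
Proof.
have := manin_mod11 i j; case E: (manin_value_at _ _) => [c|]; last by [].
move=> [<-]; rewrite natr_Zp.
exact: (manin_value_atP intpoly_frac_inj (derivation_frac_deriv _) (red_gen_u _) der_gen_u E).
Qed.

Lemma family_neq0 e : neq0_at (3%:R : 'F_11) e -> interp env e != 0.
Proof.
exact: (neq0_atP intpoly_frac_inj (derivation_frac_deriv _) (red_gen_u _) der_gen_u).
Qed.

Lemma der_family_neq0 e : der_neq0_at (3%:R : 'F_11) e -> ddu (interp env e) != 0.
Proof.
exact: (der_neq0_atP intpoly_frac_inj (derivation_frac_deriv _) (red_gen_u _) der_gen_u).
Qed.

Lemma twist_n_neq0 : twist_n != 0.
Proof. by apply: family_neq0; vm_compute. Qed.

Lemma der_twist_a_neq0 : ddu twist_a != 0.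
Proof. by apply: (@der_family_neq0 (EMul Ealpha (EInv En))); vm_compute. Qed.

Definition manin_rows_inverse : seq (seq nat) :=
  [:: [:: 0; 0; 0; 4; 7]; [:: 7; 10; 4; 8; 1]; [:: 5; 10; 7; 0; 3];
      [:: 4; 9; 0; 10; 3]; [:: 7; 0; 3; 1; 8]]%N.

Definition mx_of (rows : seq (seq nat)) : 'M['F_11]_5 :=
  \matrix_(j, i) (nth 0%N (nth [::] rows j) i)%:R.

Lemma manin_rows_inverseP : mx_of manin_rows_inverse *m mx_of manin_rows = 1%:M.
Proof.
apply/matrixP => i j; rewrite !mxE !big_ord_recl big_ord0 !mxE; apply/eqP.
by case: i => [[|[|[|[|[|//]]]]] ?]; case: j => [[|[|[|[|[|//]]]]] ?]; vm_compute.
Qed.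

(** Reducing a relation at the five places gives a square linear system over the
    field with 11 elements whose matrix is invertible. *)
Lemma manin_relation_mod11 (c : 'I_5 -> int) :
  \sum_i manin_gen i *~ c i = 0 -> forall i, (11 %| c i)%Z.
Proof.
move=> hc; pose C : 'cV['F_11]_5 := \col_i (c i)%:~R.
have h (j : 'I_5) : \sum_(i < 5) (nth 0%N (nth [::] manin_rows j) i)%:R * (c i)%:~R = 0 :> 'F_11.
  apply: (red0_eq0 intpoly_frac_inj (ev := eval_mod11 (j + 3)%:R)); rewrite -hc.
  elim/big_ind2: _ => [|x1 x2 y1 y2|i _]; first exact: (red_nat _ _ 0).
    exact: redD.
  rewrite -mulrzr; apply: redM; first exact: red_manin_gen.
  rewrite -(rmorph_int intpoly_frac) -(rmorph_int (eval_mod11 (j + 3)%:R)); exact: red_ring.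
have hC : mx_of manin_rows *m C = 0.
  apply/matrixP => j k; rewrite !mxE -[RHS](h j).
  by apply: eq_bigr => i _; rewrite !mxE.
have C0 : C = 0 by rewrite -[C]mul1mx -manin_rows_inverseP -mulmxA hC mulmx0.
move=> i; rewrite (dvdz_pcharf (pchar_Fp (isT : prime 11))).
by have /matrixP/(_ i 0) := C0; rewrite !mxE => ->.
Qed.

Lemma natr_neq0 k : (k.+1%:R : ratfun) != 0.
Proof.
by rewrite -(rmorph_nat (@tofrac {poly rat})) tofrac_eq0 -polyC_natr polyC_eq0 pnatr_eq0.
Qed.

Lemma manin_gen_free (c : 'I_5 -> int) : \sum_i manin_gen i *~ c i = 0 -> forall i, c i = 0.
Proof.
apply: (@relation_descent _ 11) => // [x|]; last exact: manin_relation_mod11.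
by move=> /eqP; rewrite -mulr_natl mulf_eq0 (negPf (natr_neq0 10)) => /eqP.
Qed.

Lemma elliptic_of_disc (K : fieldType) (a n : K) :
  (2 : K) != 0 -> n != 0 -> a ^+ 2 + 4 * n ^+ 2 != 0 ->
  is_elliptic (Cubic a (- n ^+ 2) 0).
Proof.
move=> h2 hn hd; rewrite /is_elliptic /disc /=.
rewrite (_ : _ * _ = 2 ^+ 4 * n ^+ 4 * (a ^+ 2 + 4 * n ^+ 2)); last by ring.
by rewrite !mulf_neq0 ?expf_neq0.
Qed.

Lemma alpha_factored (K : fieldType) (u w r s : K) :
  u ^+ 4 * w ^+ 2 + 4 * w ^+ 4 - 8 * w ^+ 4 * u
               + 4 * w ^+ 4 * u ^+ 2 + 8 * w ^+ 2 - 16 * w ^+ 2 * u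
               + 12 * w ^+ 2 * u ^+ 2 + 4 - 8 * u + 4 * u ^+ 2
               - 4 * w ^+ 2 * u ^+ 3 = interp [:: u; w; r; s] Ealpha.
Proof. by rewrite /=; ring. Qed.

Lemma n_square (K : fieldType) (u w r s : K) :
  (w ^+ 4 - 1) ^+ 2 * u ^+ 2 * (u - 2) ^+ 2 * (u - 1) ^+ 2
   = interp [:: u; w; r; s] En ^+ 2.
Proof. by rewrite /=; ring. Qed.

(** * The theorem *)

Section Family.
Variable E : cubic ratfun.
Hypotheses (E2 : a2 E = interp env Ealpha) (E4 : a4 E = - interp env En ^+ 2) (E6 : a6 E = 0).
Let x_ (i : 'I_5) := interp env (gen_coords i).1.
Let y_ (i : 'I_5) := interp env (gen_coords i).2.

Lemma family_elliptic : is_elliptic E.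
Proof.
have d0 : interp env Edisc != 0 by apply: family_neq0; vm_compute.
have -> : E = Cubic (interp env Ealpha) (- interp env En ^+ 2) 0.
  by case: E E2 E4 E6 => a b c /= -> -> ->.
by apply: elliptic_of_disc; [exact: (natr_neq0 1) | exact: twist_n_neq0 | exact: d0].
Qed.

Lemma family_point i : on_curve E (Affine (x_ i) (y_ i)).
Proof.
have u1 : gen_u - 1 != 0 by apply: (@family_neq0 (EVar 0 - 1%N)%expr); vm_compute.
have B0 : interp [:: gen_u] EB != 0 by apply: (@family_neq0 EB); vm_compute.
exact: (points_on_curve u1 B0 (ltn_ord i) E2 E4 E6).
Qed.

(** An abscissa determines the point up to sign, and the Manin map is odd, so the
    images of the given points are those of the computed ones up to signs that
    the coefficients absorb. *)
Lemma family_independent (P : 'I_5 -> mw_point E) :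
  (forall i, has_x (P i) (x_ i)) -> lin_indep P.
Proof.
move=> hP c hc.
pose f (Q : mw_point E) := manin_point ddu twist_n twist_a Q.
have f_opp : {morph f : Q / mw_opp Q >-> - Q}.
  move=> Q; exact: (manin_point_opp (derivation_frac_deriv _)
    (natr_neq0 1) twist_n_neq0 der_twist_a_neq0).
have f_add : {morph f : Q S / mw_add Q S >-> Q + S}.
  move=> Q S; apply: (manin_point_add (derivation_frac_deriv _)
    (natr_neq0 1) twist_n_neq0 der_twist_a_neq0) => //.
  - by rewrite E2 mulrC divfK // twist_n_neq0.
  - exact: mw_valP.
  - exact: mw_valP.
have := hom_sum f_add f_opp (erefl 0) P c; rewrite hc => /esym hsum.
have sgn i : exists2 d : int, d != 0 & f (P i) = manin_gen i *~ d.
  have [y hy] := hP i.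
  have : y ^+ 2 == y_ i ^+ 2.
    have /eqP -> := family_point i.
    by have := mw_valP (P i); rewrite hy.
  rewrite eqf_sqr => /orP[/eqP ey|/eqP ey]; [exists 1 | exists (-1)] => //.
    by rewrite /f hy ey mulr1z.
  have -> : f (P i) = - f (MWPoint (family_point i)).
    by rewrite -f_opp /f hy /= ey.
  by rewrite mulrNz mulr1z.
have [d d0 fd] := fin_all_exists2 sgn.
have cd : forall i, c i * d i = 0.
  apply: manin_gen_free => //; rewrite -[RHS]hsum; apply: eq_bigr => i _.
  by rewrite fd mulrzl -mulrzA [c i * _]mulrC.
by move=> i; have /eqP := cd i; rewrite mulf_eq0 (negPf (d0 i)) orbF => /eqP.
Qed.
End Family.

Theorem mainTheorem4 :
  let u : ratfun := tofrac ('X : {poly rat}) in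
  let m := - (4 * (u - 1)
              * (u ^+ 8 - 8 * u ^+ 7 + 34 * u ^+ 6 - 92 * u ^+ 5
                 + 178 * u ^+ 4 - 248 * u ^+ 3 + 232 * u ^+ 2
                 - 128 * u + 32))
           / ((u ^+ 2 - 2 * u + 4) * (3 * u ^+ 2 - 6 * u + 4) ^+ 2) in
  let w := (m ^+ 2 + 2 * (u - 1) * (u ^+ 2 - 2 * u + 4) * m
              + 8 * (u - 1) ^+ 2)
           / ((u - 1) * m ^+ 2 - 8 * (u - 1) ^+ 3) in
  let alpha := u ^+ 4 * w ^+ 2 + 4 * w ^+ 4 - 8 * w ^+ 4 * u
               + 4 * w ^+ 4 * u ^+ 2 + 8 * w ^+ 2 - 16 * w ^+ 2 * u
               + 12 * w ^+ 2 * u ^+ 2 + 4 - 8 * u + 4 * u ^+ 2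
               - 4 * w ^+ 2 * u ^+ 3 in
  let n2 := (w ^+ 4 - 1) ^+ 2 * u ^+ 2 * (u - 2) ^+ 2 * (u - 1) ^+ 2 in
  let E : cubic ratfun := {| a2 := alpha; a4 := - n2; a6 := 0 |} in
  let x : seq ratfun := [:: - ((w - 1) ^+ 2 * (w + 1) ^+ 2 * u ^+ 2 * (u - 1));
            - (u ^+ 2 * w ^+ 2 * (u - 2) ^+ 2);
            - (4 * (w ^+ 2 + 1) ^+ 2 * (u - 1) ^+ 2);
            (w ^+ 4 - 1) * u ^+ 2 * (u - 1);
            - (u ^+ 2 * (u - 1) * (w ^+ 4 - 1))] in
  is_elliptic E
  /\ (forall i : 'I_5, exists P : mw_point E, has_x P (x`_i))
  /\ (forall P : 'I_5 -> mw_point E,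
        (forall i, has_x (P i) (x`_i)) -> lin_indep P)
  /\ rank_ge E 5.
Proof.
move=> u m w alpha n2 E x.
have ew : w = interp [:: gen_u] Ew.
  apply: w_of_m.
  - exact: (natr_neq0 1).
  - by apply: (@family_neq0 (EVar 0 - 1%N)%expr); vm_compute.
  - by apply: (@family_neq0 (EVar 0 ^+ 2 - 2%N * EVar 0 + 4%N)%expr); vm_compute.
  - by apply: (@family_neq0 (3%N * EVar 0 ^+ 2 - 6%N * EVar 0 + 4%N)%expr); vm_compute.
  - by apply: (@family_neq0 EB); vm_compute.
have E2 : a2 E = interp (env_of gen_u) Ealpha by rewrite /env_of -ew -alpha_factored.
have E4 : a4 E = - interp (env_of gen_u) En ^+ 2 by rewrite /env_of -ew -n_square.
have xE (i : 'I_5) : x`_i = interp (env_of gen_u) (gen_coords i).1.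
  by rewrite /env_of -ew; case: i => [[|[|[|[|[|//]]]]] ?].
clearbody w.
have pts (i : 'I_5) : exists P : mw_point E, has_x P x`_i.
  by exists (MWPoint (family_point E2 E4 (erefl 0) i)); rewrite xE; eexists.
have ind (P : 'I_5 -> mw_point E) : (forall i : 'I_5, has_x (P i) x`_i) -> lin_indep P.
  move=> hP; apply: (family_independent E2 E4 (erefl 0)) => i.
  by rewrite -xE.
split; first exact: (family_elliptic E2 E4 (erefl 0)).
split=> //; split=> //.
have [P hP] := fin_all_exists pts.
by exists P; apply: ind.
Qed.
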